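(* Let $G$ be a finitely generated group and let $\varphi:G\times X\to X$ be a continuous action on a compact metric space $(X,d)$ without isolated points. If every non-atomic Borel probability measure $\mu$ on $X$ is compatible with the persistent shadowing property for $\varphi$, then $\varphi$ has the persistent shadowing property.
   Context: Fix a finite generating set $S$ of $G$ (discrete topology). For continuous actions $\varphi,\psi$ of $G$ on $X$ put $d_S(\varphi,\psi)=\sup\{d(\varphi(s,x),\psi(s,x)): x\in X, s\in S\}$. A map $f:G\to X$ is a $\delta$-pseudo orbit for $\psi$ if $d(f(sg),\psi(s,f(g)))<\delta$ for all $s\in S$, $g\in G$; it is $(\psi,\epsilon)$-shadowed by $p\in X$ if $d(f(g),\psi(g,p))<\epsilon$ for all $g\in G$. $\varphi$ has the persistent shadowing property if for every $\epsilon>0$ there is $\delta>0$ such that for every continuous action $\psi:G\times X\to X$ with $d_S(\varphi,\psi)<\delta$, every $\delta$-pseudo orbit for $\psi$ is $(\psi,\epsilon)$-shadowed by a point of $X$. $Sh_\psi(\delta,\epsilon)$ is the set of $x\in X$ such that every $\delta$-pseudo orbit $f$ for $\psi$ with $f(e)=x$ is $(\psi,\epsilon)$-shadowed by a point of $X$. A Borel probability measure $\mu$ on $X$ is compatible with the persistent shadowing property for $\varphi$ if for every $\epsilon>0$ there is $\delta>0$ such that for every Borel set $A\subseteq X$ with $\mu(A)>0$ one has $A\cap Sh_\psi(\delta,\epsilon)\neq\emptyset$ for every continuous action $\psi:G\times X\to X$ with $d_S(\varphi,\psi)<\delta$. *)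

(* Defs.v *)
From HB Require Import structures.
From mathcomp Require Import all_boot all_order all_algebra all_fingroup.
From mathcomp Require Import all_classical all_reals all_analysis.

Set Implicit Arguments.
Unset Strict Implicit.
Unset Printing Implicit Defensive.

Import Order.TTheory GRing.Theory Num.Theory.

Local Open Scope classical_set_scope.
Local Open Scope ring_scope.

Definition generates (G : groupType) (S : set G) : Prop :=
  forall H : {pred G}, group_closed H ->
    (forall s, S s -> s \in H) -> forall g, g \in H.

(* The library attaches sigma-algebras to pointed types only. Instead of
   assuming the space pointed, which would exclude the empty one, we let the
   base point be a parameter; it plays no role in the sigma-algebra. *)
Definition pointed_at (T : choiceType) (x0 : T) : Type := T.
HB.instance Definition _ (T : choiceType) (x0 : T) :=
  Choice.copy (pointed_at x0) T.
HB.instance Definition _ (T : choiceType) (x0 : T) :=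
  isPointed.Build (pointed_at x0) x0.

Definition borelType (X : topologicalType) (x0 : X) :=
  g_sigma_algebraType (@open X : set (set (pointed_at x0))).

Section atoms.
Context d (T : measurableType d) (R : realType).
Local Open Scope ereal_scope.

Definition is_atom (mu : {measure set T -> \bar R}) (A : set T) : Prop :=
  [/\ measurable A, 0 < mu A &
      forall B, measurable B -> B `<=` A -> mu B < mu A -> mu B = 0].

Definition non_atomic (mu : {measure set T -> \bar R}) : Prop :=
  forall A, ~ is_atom mu A.

End atoms.

Section shadowing.
Context (R : realType) (G : groupType) (X : metricType R).
Implicit Types (phi psi : G * X -> X) (f : G -> X) (S : set G).

Definition continuous_action phi : Prop :=
  [/\ continuous (phi : discrete_topology G * X -> X),
      forall x, phi (1%g, x) = x &
      forall g h x, phi ((g * h)%g, x) = phi (g, phi (h, x))].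

(* The supremum is taken in the extended reals; it is -oo when S or X is
   empty, so that the bound action_dist < delta is then void. *)
Definition action_dist S phi psi : \bar R :=
  ereal_sup [set (mdist (phi (s, x)) (psi (s, x)))%:E | x in [set: X] & s in S].

Definition pseudo_orbit S psi (delta : R) f : Prop :=
  forall s g, S s -> mdist (f (s * g)%g) (psi (s, f g)) < delta.

Definition shadowed psi (eps : R) f (p : X) : Prop :=
  forall g, mdist (f g) (psi (g, p)) < eps.

Definition persistent_shadowing S phi : Prop :=
  forall eps : R, 0 < eps -> exists2 delta : R, 0 < delta &
    forall psi, continuous_action psi ->
      (action_dist S phi psi < delta%:E)%E ->
      forall f, pseudo_orbit S psi delta f -> exists p, shadowed psi eps f p.

Definition Sh S psi (delta eps : R) : set X :=
  [set x | forall f, pseudo_orbit S psi delta f -> f 1%g = x ->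
             exists p, shadowed psi eps f p].

Definition compatible S phi (x0 : X) (mu : probability (borelType x0) R)
    : Prop :=
  forall eps : R, 0 < eps -> exists2 delta : R, 0 < delta &
    forall A : set X, measurable (A : set (borelType x0)) -> (0 < mu A)%E ->
      forall psi, continuous_action psi ->
        (action_dist S phi psi < delta%:E)%E ->
        A `&` Sh S psi delta eps !=set0.

End shadowing.

(* Main.v *)
From HB Require Import structures.
Require Import Defs.
From mathcomp Require Import all_boot all_order all_algebra all_fingroup.
From mathcomp Require Import all_classical all_reals all_analysis.
From mathcomp Require Import lra zify.

Set Implicit Arguments.
Unset Strict Implicit.
Unset Printing Implicit Defensive.

Import Order.TTheory GRing.Theory Num.Theory.

Local Open Scope classical_set_scope.
Local Open Scope ring_scope.

(** Suppose that [phi] fails persistent shadowing at the scale [eps]. Then for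
    each [n] there are an action [psi_n] within [1 / (n + 1)] of [phi] and a
    [1 / (n + 1)]-pseudo orbit [f_n] of [psi_n] which no point
    [eps]-shadows. Only finitely many strict inequalities in the definition of
    a pseudo orbit involve the value at the identity, because [S] is finite;
    so [f_n 1] may be moved freely inside a small ball [B_n], keeping the other
    values, and the result is still a [1 / (n + 1)]-pseudo orbit. For a small
    radius it is not even [eps / 2]-shadowed, so that the whole ball [B_n]
    misses [Sh psi_n (1 / (n + 1)) (eps / 2)]: failure at one point spreads to
    an open set ([unshadowed_ball_disjoint_Sh]).

    A non-atomic probability measure [mu] that charges every [B_n] is therefore
    incompatible with persistent shadowing: whatever [delta] is proposed for
    [eps / 2], the set [B_n] with [1 / (n + 1) < delta] contradicts it. It is
    essential that a single [mu] serves all [n], since [delta] depends on [mu].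

    Such a [mu] exists because [X] is compact without isolated points. Inside
    any ball the absence of isolated points gives a Cantor scheme: a binary
    tree of nested closed disks, disjoint at each level, with radii tending to
    zero ([cantor_scheme]). By compactness the binary expansion of a real
    [t] with [0 <= t < 1] determines a branch, hence a point [h t] of the ball.
    The push-forward of Lebesgue measure by [h] gives each disk of level [n]
    mass at most [2 ^- n], and a measure that can be cut into arbitrarily light
    pieces has no atom ([exists_non_atomic]). Averaging one such measure for
    each [B_n] with the weights [2 ^- n.+1] keeps non-atomicity and charges
    every ball ([non_atomic_mixture]). *)

(** * Failure of shadowing on an open set *)

Lemma action_slice_near (R : realType) (G : groupType) (X : metricType R)
    (psi : G * X -> X) (s : G) (x : X) (e : R) :
  continuous_action psi -> 0 < e ->
  \forall y \near x, mdist (psi (s, x)) (psi (s, y)) < e.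
Proof.
move=> [cpsi _ _] e0.
have cs : psi (s, y) @[y --> x] --> psi (s, x).
  apply: (@cvg_comp2 _ _ _ _ (nbhs x) (nbhs (s : discrete_topology G)) (nbhs x)
    (nbhs (psi (s, x))) _ _ _ (cst s) id (fun a b => psi (a, b))) => //.
    exact: (@cvg_cst (discrete_topology G)).
  rewrite (_ : (fun _ => _) = psi); last by apply/funext => -[].
  exact: cpsi (s, x).
by move: cs => /metricType_numDomainType.cvgrPdist_lt/(_ _ e0).
Qed.

(** The value at [1] enters the pseudo-orbit inequalities only for the pairs
    [(s, 1)] and [(s, s^-1)] with [s] in [S]: finitely many strict inequalities,
    each of which is an open condition on that value. *)
Lemma pseudo_orbit_perturb (R : realType) (G : groupType) (X : metricType R)
    (S : set G) (psi : G * X -> X) (delta : R) (f : G -> X) :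
  finite_set S -> continuous_action psi -> 0 < delta ->
  pseudo_orbit S psi delta f ->
  \forall y \near f 1%g,
    pseudo_orbit S psi delta (fun g => if g == 1%g then y else f g).
Proof.
move=> finS actpsi delta0 pof.
pose P s y := s != 1%g -> mdist (f s) (psi (s, y)) < delta /\
                         mdist y (psi (s, f s^-1%g)) < delta.
have nearP s : S s -> \forall y \near f 1%g, P s y.
  move=> Ss.
  (* For s = 1 both pairs coincide and compare the new value y with itself. *)
  have [s1|s1] := boolP (s == 1%g).
    by apply: nearW => y; rewrite /P s1.
  have d1 := pof s 1%g Ss; rewrite mulg1 in d1.
  have d2 := pof s (s^-1)%g Ss; rewrite mulgV in d2.
  have e1 : 0 < delta - mdist (f s) (psi (s, f 1%g)) by rewrite subr_gt0.
  have e2 : 0 < delta - mdist (f 1%g) (psi (s, f s^-1%g)) by rewrite subr_gt0.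
  have n1 := action_slice_near s (f 1%g) actpsi e1.
  have n2 : \forall y \near f 1%g,
      mdist (f 1%g) y < delta - mdist (f 1%g) (psi (s, f s^-1%g)).
    apply/metricType_numDomainType.nbhs_mdistP.
    by exists (delta - mdist (f 1%g) (psi (s, f s^-1%g))).
  apply: filterS2 n1 n2 => y y1 y2 _; split.
    have := metric_triangle (f s) (psi (s, f 1%g)) (psi (s, y)); lra.
  have := metric_triangle y (f 1%g) (psi (s, f s^-1%g)).
  by rewrite (metric_sym y (f 1%g)); lra.
have /finite_fsetP[F SF] := finS.
have : \forall y \near f 1%g, forall s, S s -> P s y.
  have := @filter_bigI _ _ F (fun s => P s) (nbhs (f 1%g)) _.
  rewrite SF; apply => s sF; apply: nearP; by rewrite SF.
apply: filterS => y Py s g Ss /=.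
have [-> | g1] := eqVneq g 1%g.
  rewrite mulg1; have [-> | s1] := eqVneq s 1%g; last by have [] := Py s Ss s1.
  by case: actpsi => _ -> _; rewrite mdistxx.
have [sg1|sg1] := eqVneq (s * g)%g 1%g; last exact: pof.
have gE : g = (s^-1)%g by rewrite -[LHS]mul1g -(mulVg s) -mulgA sg1 mulg1.
have s1 : s != 1%g by apply: contra g1 => /eqP s1; rewrite gE s1 invg1.
by have [_] := Py s Ss s1; rewrite gE.
Qed.

(** If a point [eps / 2]-shadowed the orbit with the value at [1] replaced by
    some [y] with [mdist (f 1) y < eps / 2], then it would [eps]-shadow [f]. *)
Lemma unshadowed_ball_disjoint_Sh (R : realType) (G : groupType)
    (X : metricType R) (S : set G) (psi : G * X -> X) (delta eps : R)
    (f : G -> X) :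
  finite_set S -> continuous_action psi -> 0 < delta -> 0 < eps ->
  pseudo_orbit S psi delta f -> (forall p, ~ shadowed psi eps f p) ->
  exists2 r : R, 0 < r & ball (f 1%g) r `&` Sh S psi delta (eps / 2) = set0.
Proof.
move=> finS actpsi delta0 eps0 pof nshf.
have e20 : 0 < eps / 2 by lra.
have near1 := pseudo_orbit_perturb finS actpsi delta0 pof.
have near2 : \forall y \near f 1%g, mdist (f 1%g) y < eps / 2.
  by apply/metricType_numDomainType.nbhs_mdistP; exists (eps / 2).
have [r /= r0 rP] :=
  (metricType_numDomainType.nbhs_mdistP _ _).1 (filterI near1 near2).
exists r => //; rewrite -subset0 ballEmdist => y [/rP[pofy yeps]].
move=> /(_ _ pofy); rewrite eqxx => /(_ erefl)[p shp].
apply: (nshf p) => g; have := shp g; case: eqP => [->|_] /=; last by lra.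
have := metric_triangle (f 1%g) y (psi (1%g, p)); lra.
Qed.

(** * Cantor schemes in spaces without isolated points *)

(** A disk is carried as the pair of its center and radius, so that the
    recursion of the Cantor scheme can read both off the parent disk. *)
Definition closed_disk (R : realType) (X : metricType R) (b : X * R) : set X :=
  [set y | mdist b.1 y <= b.2].

Lemma closed_closed_disk (R : realType) (X : metricType R) (b : X * R) :
  closed (closed_disk b).
Proof.
move=> y cly; rewrite /closed_disk/=; apply/ler_addgt0Pr => e e0.
have [z [bz yz]] := cly _ (nbhsx_ballx y e e0).
rewrite ballEmdist/= in yz.
rewrite (le_trans (metric_triangle _ z _))// lerD// metric_sym.
exact: ltW.
Qed.

Lemma perfect_other_point (R : realType) (X : metricType R) (c : X) (r : R) :
  isolated [set: X] = set0 -> 0 < r -> exists2 c', c' != c & mdist c c' < r.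
Proof.
move=> noiso r0; apply: contrapT => nex.
suff : isolated [set: X] c by rewrite noiso.
split; first by rewrite inE.
exists (ball c r); first exact: nbhsx_ballx.
rewrite setIT; apply/seteqP; split=> [y cy|_ ->]; last exact: ballxx.
rewrite ballEmdist/= in cy.
apply: contrapT => yc; apply: nex; exists y => //.
by apply/eqP => ?; exact: yc.
Qed.

(** Keep the center [c], take as second center a point [c'] closer than half
    the radius, and give both disks a quarter of the distance from [c] to [c']
    as radius, or [e] if that is smaller. *)
Lemma closed_disk_split (R : realType) (X : metricType R) (b : X * R) (e : R) :
  isolated [set: X] = set0 -> 0 < b.2 -> 0 < e ->
  exists s : bool -> X * R, [/\ forall i, 0 < (s i).2 <= e,
    forall i, closed_disk (s i) `<=` closed_disk b &
    closed_disk (s false) `&` closed_disk (s true) = set0].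
Proof.
case: b => c r /= noiso r0 e0.
have [|c' c'c cc'] := @perfect_other_point _ _ c (r / 2) noiso; first by lra.
rewrite eq_sym -mdist_gt0 in c'c.
pose d := Num.min (mdist c c' / 4) e.
have d0 : 0 < d by rewrite lt_min e0 divr_gt0.
have d4 : d <= mdist c c' / 4 by rewrite ge_min lexx.
have de : d <= e by rewrite ge_min lexx orbT.
exists (fun i => (if i then c' else c, d)); split => [i|i y|] /=.
- by rewrite d0.
- rewrite /closed_disk/=; case: i => yd; last by lra.
  have := metric_triangle c c' y; lra.
- rewrite -subset0 => y [] /=; rewrite /closed_disk/= => cy c'y.
  have := metric_triangle c y c'; rewrite (metric_sym y c'); lra.
Qed.

(** The children of the cell [k] of level [n] are the cells [k.*2] and
    [k.*2.+1] of level [n.+1]. This is the numbering of dyadic intervals, which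
    links the scheme to binary expansions; the cells that matter at level [n]
    are those with [k < 2 ^ n], and disjointness is
    claimed for these only. *)
Lemma cantor_scheme (R : realType) (X : metricType R) (c0 : X) (r0 : R) :
  isolated [set: X] = set0 -> 0 < r0 ->
  exists C : nat -> nat -> set X, [/\
    forall n k, closed (C n k) /\ C n k !=set0,
    forall n k, C n.+1 k `<=` C n k./2,
    forall n k k', (k < 2 ^ n)%N -> (k' < 2 ^ n)%N -> k != k' ->
      C n k `&` C n k' = set0,
    forall n k x y, C n.+1 k x -> C n.+1 k y -> mdist x y <= 2 / n.+1%:R &
    forall k, C 0 k `<=` ball c0 r0].
Proof.
move=> noiso r00.
have /choice[step stepP] : forall p : (X * R) * nat, exists s : bool -> X * R,
    0 < p.1.2 -> [/\ forall i, 0 < (s i).2 <= p.2.+1%:R^-1,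
    forall i, closed_disk (s i) `<=` closed_disk p.1 &
    closed_disk (s false) `&` closed_disk (s true) = set0].
  move=> [b n] /=; have [b0|b0] := ltP 0 b.2; last first.
    by exists (fun=> b).
  have [|s sP] := @closed_disk_split _ _ b n.+1%:R^-1 noiso b0.
    by rewrite invr_gt0.
  by exists s.
pose D := fix D n k : X * R :=
  if n is m.+1 then step (D m k./2, m) (odd k) else (c0, r0 / 2).
have D0 n k : 0 < (D n k).2.
  elim: n k => [|n IH] k /=; first by lra.
  by have [/(_ (odd k))/andP[]] := stepP (D n k./2, n) (IH _).
have DS n k := stepP (D n k./2, n) (D0 n _).
exists (fun n k => closed_disk (D n k)); split.
- move=> n k; split; first exact: closed_closed_disk.
  by exists (D n k).1; rewrite /closed_disk/= mdistxx ltW.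
- by move=> n k; have [_ /(_ (odd k))] := DS n k.
(* Two cells with distinct parents are separated by the parents; two cells with
   the same parent are its two halves. *)
- elim=> [|n IH] k k' kn k'n kk'.
    by move: kn k'n kk'; rewrite expn0 !ltnS !leqn0 => /eqP -> /eqP ->.
  have [E|/eqP E] := eqVneq k./2 k'./2; last first.
    have [_ sub _] := DS n k; have [_ sub' _] := DS n k'.
    rewrite -subset0 => y [/= ky k'y].
    rewrite expnS in kn; rewrite expnS in k'n.
    suff : (closed_disk (D n k./2) `&` closed_disk (D n k'./2)) y.
      by rewrite IH; [|lia|lia|exact/eqP].
    by split; [exact: sub ky|exact: sub' k'y].
  have odkk' : odd k' = ~~ odd k by move: kk' E; lia.
  have [_ _ dis] := DS n k; rewrite /= -E odkk'; case: (odd k) => //=.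
  by rewrite setIC.
- move=> n k x y; rewrite /closed_disk => Cx Cy.
  have [/(_ (odd k))/andP[_ rn] _ _] := DS n k; move: Cx Cy rn => /=.
  set b := step _ _ => bx bye bn; have := metric_triangle x b.1 y.
  by rewrite (metric_sym x b.1); move: bn; set q := n.+1%:R^-1; lra.
- move=> k y; rewrite /closed_disk ballEmdist /= => cy; lra.
Qed.

(** * Binary expansions and the coding map *)

Lemma truncn_double_half (R : realType) (x : R) :
  (Num.truncn (2 * x))./2 = Num.truncn x.
Proof.
have [x0|x0] := leP 0 x; last first.
  by rewrite !(truncn0Pn _ _)// -ltNge; lra.
have /andP[kx xk] := truncn_itv x0.
have [|jx xj] := andP (@truncn_itv _ (2 * x) _); first by lra.
set k := Num.truncn x in kx xk *; set j := Num.truncn _ in jx xj *.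
have jk : (j < k.+1.*2)%N.
  by rewrite -(ltr_nat R) -muln2 natrM (le_lt_trans jx)// mulrC ltr_pM2r.
have kj : (k.*2 < j.+1)%N.
  by rewrite -(ltr_nat R) -muln2 natrM (le_lt_trans _ xj)// mulrC ler_pM2l.
lia.
Qed.

(** For [0 <= t < 1], the integer whose binary digits are the first [n] binary
    digits of [t]. *)
Definition dyadic_cell (R : realType) (n : nat) (t : R) : nat :=
  Num.truncn (2 ^+ n * t).

Lemma dyadic_cellS (R : realType) (n : nat) (t : R) :
  (dyadic_cell n.+1 t)./2 = dyadic_cell n t.
Proof. by rewrite /dyadic_cell exprS -mulrA truncn_double_half. Qed.

Lemma dyadic_cell_lt (R : realType) (n : nat) (t : R) :
  0 <= t < 1 -> (dyadic_cell n t < 2 ^ n)%N.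
Proof.
move=> /andP[t0 t1]; rewrite /dyadic_cell truncn_lt_nat.
  by rewrite natrX gtr_pMr// exprn_gt0.
by rewrite mulr_ge0// exprn_ge0.
Qed.

Lemma measurable_dyadic_cell (R : realType) (n k : nat) :
  measurable ([set t | dyadic_cell n t = k] : set (measurableTypeR R)).
Proof.
have mle j :
    measurable ([set t | (dyadic_cell n t <= j)%N] : set (measurableTypeR R)).
  rewrite (_ : [set t | _] = `]-oo, (j.+1%:R / 2 ^+ n)[%classic).
    exact: measurable_itv.
  by apply/seteqP; split=> t;
    rewrite /= in_itv/= truncn_le_nat ltr_pdivlMr ?exprn_gt0// mulrC.
case: k => [|k].
  rewrite (_ : [set t | _] = [set t | (dyadic_cell n t <= 0)%N]).
    exact: mle.
  by apply/seteqP; split=> t /=; rewrite leqn0 => /eqP.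
rewrite (_ : [set t | _] = [set t | (dyadic_cell n t <= k.+1)%N] `\`
                           [set t | (dyadic_cell n t <= k)%N]).
  exact: measurableD.
by apply/seteqP; split=> t /=; [move=> ->; split; lia|move=> [? /negP ?]; lia].
Qed.

Lemma lebesgue_dyadic_cell (R : realType) (n k : nat) :
  (lebesgue_measure ([set t : R | dyadic_cell n t = k] `&` `[0%R, 1%R[)
    <= (2 ^- n)%:E)%E.
Proof.
have n0 : 0 < 2 ^+ n :> R by rewrite exprn_gt0.
apply: (@le_trans _ _
  (@lebesgue_measure R `[k%:R / 2 ^+ n, k.+1%:R / 2 ^+ n[%classic)).
  apply: le_measure; rewrite ?inE.
  - apply: measurableI; [exact: measurable_dyadic_cell|exact: measurable_itv].
  - exact: measurable_itv.
  - move=> t /= [tk]; rewrite !in_itv/= => /andP[t0 t1].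
    rewrite ler_pdivrMr// ltr_pdivlMr// mulrC -truncn_eq ?mulr_ge0 ?exprn_ge0//.
    exact/eqP.
rewrite lebesgue_measure_itv/= lte_fin ltr_pM2r ?invr_gt0// ltr_nat ltnSn.
by rewrite -EFinB lee_fin -mulrBl -natr1 [_ + 1]addrC addrK mul1r.
Qed.

(** The cells containing the successive dyadic truncations of [t] are closed,
    nonempty and nested, so by compactness they have a common point. *)
Lemma compact_coding (R : realType) (X : metricType R)
    (C : nat -> nat -> set X) :
  compact [set: X] ->
  (forall n k, closed (C n k) /\ C n k !=set0) ->
  (forall n k, C n.+1 k `<=` C n k./2) ->
  exists h : R -> X, forall t n, C n (dyadic_cell n t) (h t).
Proof.
move=> cX CC CS.
suff /choice[h hC] : forall t : R, exists p, forall n, C n (dyadic_cell n t) p.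
  by exists h.
move=> t.
have /choice[c cP] : forall n, exists c, C n (dyadic_cell n t) c.
  by move=> n; have [_] := CC n (dyadic_cell n t).
have mono m n : (n <= m)%N ->
    C m (dyadic_cell m t) `<=` C n (dyadic_cell n t).
  elim: m => [|m IH]; first by rewrite leqn0 => /eqP ->.
  rewrite leq_eqVlt => /predU1P[->//|nm].
  by apply: subset_trans (IH nm); rewrite -(dyadic_cellS m); exact: CS.
have [p [_ clp]] := cX (c @ \oo) _ filterT.
exists p => n; have [clC _] := CC n (dyadic_cell n t).
apply: clC => B Bp; apply: clp => //.
by exists n => // m /= nm; apply: mono nm _ (cP m).
Qed.

(** As the cells shrink, [h t] lies in an open set [U] exactly when some cell
    of [t] is contained in [U]. Hence [h @^-1` U] is a countable union of sets
    on which the first binary digits are prescribed. *)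
Lemma measurable_coding (R : realType) (X : metricType R) (x0 : X)
    (C : nat -> nat -> set X) (h : R -> X) :
  (forall n k x y, C n.+1 k x -> C n.+1 k y -> mdist x y <= 2 / n.+1%:R) ->
  (forall t n, C n (dyadic_cell n t) (h t)) ->
  measurable_fun [set: measurableTypeR R]
    (h : measurableTypeR R -> borelType x0).
Proof.
move=> Cdiam hC.
apply: (@measurability _ _ _ _ _ _ (@open X : set (set (borelType x0)))) => //.
move=> _ [U oU <-]; rewrite setTI.
rewrite (_ : h @^-1` U = \bigcup_n \bigcup_(k in [set k | C n k `<=` U])
    [set t | dyadic_cell n t = k]).
  apply: bigcup_measurable => n _; apply: bigcup_measurable => k _.
  exact: measurable_dyadic_cell.
apply/seteqP; split=> [t /= Ut|t [n _ [k /= CU tk]]]; last first.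
  by apply: CU; rewrite -tk; exact: hC.
have : nbhs (h t) U by apply: open_nbhs_nbhs.
rewrite -metricType_numDomainType.nbhs_nbhs_mdist => -[/= e e0 eU].
pose n := Num.truncn (2 / e).
have ne : 2 / n.+1%:R < e.
  by rewrite ltr_pdivrMr// mulrC -ltr_pdivrMr// truncnS_gt.
exists n.+1 => //; exists (dyadic_cell n.+1 t) => //= y Cy.
by apply: eU => /=; apply: le_lt_trans ne; apply: Cdiam (hC _ _) Cy.
Qed.

(** * Non-atomic measures charging prescribed balls *)

Lemma metric_ball_open (R : realType) (X : metricType R) (c : X) (r : R) :
  open (ball c r).
Proof.
rewrite openE => x; rewrite ballEmdist => /= cx; rewrite /interior.
apply/metricType_numDomainType.nbhs_mdistP.
exists (r - mdist c x) => /=; first by rewrite subr_gt0.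
move=> y /= xy; have := metric_triangle c x y; lra.
Qed.

Lemma measurable_borel_closed (X : topologicalType) (x0 : X) (A : set X) :
  closed A -> measurable (A : set (borelType x0)).
Proof.
move=> /closed_openC oA; rewrite -[A]setCK.
by apply: (@measurableC _ (borelType x0)); exact: sub_sigma_algebra.
Qed.

(** At level [n] the cells of the scheme carry the whole mass, and each one at
    most [2 ^- n]. If [2 ^- n < mu A], then every piece [A `&` C n k] is lighter
    than [A]; were [A] an atom, all these pieces would be null, and so would
    [A]. *)
Lemma exists_non_atomic (R : realType) (X : metricType R) (x0 c0 : X) (r0 : R) :
  compact [set: X] -> isolated [set: X] = set0 -> 0 < r0 ->
  exists mu : probability (borelType x0) R,
    non_atomic mu /\ mu (ball c0 r0) = 1%E.
Proof.
move=> cX noiso r00.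
have [C [CC CS Cdis Cdiam C0]] := cantor_scheme c0 noiso r00.
have [h hC] := compact_coding cX CC CS.
have mh := measurable_coding (x0 := x0) Cdiam hC.
pose nu := mrestr (@lebesgue_measure R) (measurable_itv `[0%R, 1%R[).
have nuT : nu setT = 1%E.
  by rewrite /nu /mrestr setTI lebesgue_measure_itv/= lte_fin ltr01 sube0.
pose P : probability (measurableTypeR R) R :=
  HB.pack nu (Measure_isProbability.Build _ _ _ nu nuT).
pose mhX : {mfun measurableTypeR R >-> borelType x0} :=
  HB.pack h (isMeasurableFun.Build _ _ (measurableTypeR R) (borelType x0) h mh).
exists (distribution P mhX); split; last first.
  rewrite /distribution /pushforward/= -nuT; congr nu.
  by apply/seteqP; split=> // t _; exact: C0 (hC t 0%N).
move=> A [mA A0 atomA].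
set mu := (distribution P mhX : {measure set _ -> \bar R}) in A0 atomA.
have muE B : mu B = lebesgue_measure (h @^-1` B `&` `[0%R, 1%R[) by [].
have mpre B : measurable (B : set (borelType x0)) ->
    measurable (h @^-1` B `&` `[0%R, 1%R[ : set (measurableTypeR R)).
  move=> mB; apply: measurableI => //.
  by rewrite -[_ @^-1` _]setTI; exact: (mh measurableT).
have mC n k : measurable (C n k : set (borelType x0)).
  by apply: measurable_borel_closed; have [] := CC n k.
have muC n k : (k < 2 ^ n)%N -> (mu (C n k) <= (2 ^- n)%:E)%E.
  move=> kn; apply: le_trans (lebesgue_dyadic_cell R n k).
  rewrite muE; apply: le_measure; rewrite ?inE.
  - exact: mpre.
  - apply: measurableI; first exact: measurable_dyadic_cell.
    exact: measurable_itv.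
  - move=> t [/= Ct t01]; split => //=; apply/eqP/negPn/negP => tk.
    have [] : set0 (h t).
    rewrite -(Cdis n (dyadic_cell n t) k _ kn tk) //.
    by apply: dyadic_cell_lt; move: t01; rewrite /= in_itv.
have [n nA] : exists n, ((2 ^- n)%:E < mu A)%E.
  have finA : mu A \is a fin_num by apply: fin_num_measure.
  have A0' : 0 < fine (mu A) by rewrite fine_gt0// A0 ltey_eq finA.
  have [n] : exists n, (fine (mu A))^-1 < 2 ^+ n.
    exists (Num.truncn (fine (mu A))^-1).+1.
    apply: (lt_le_trans (truncnS_gt _)).
    by rewrite -natrX ler_nat ltnW// ltn_expl.
  by exists n; rewrite -(fineK finA) lte_fin invf_plt ?posrE ?exprn_gt0.
have AC0 k : (k < 2 ^ n)%N -> mu (A `&` C n k) = 0%E.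
  move=> kn; apply: atomA.
  - exact: measurableI.
  - by move=> x [].
  - apply: le_lt_trans nA; apply: le_trans (muC n k kn).
    apply: le_measure; rewrite ?inE; [exact: measurableI|exact: mC|].
    by move=> x [].
suff : mu A = 0%E by move=> muA0; rewrite muA0 ltxx in A0.
rewrite muE; apply: measure_negligible; first exact: mpre.
pose F k : set (measurableTypeR R) :=
  if (k < 2 ^ n)%N then h @^-1` (A `&` C n k) `&` `[0%R, 1%R[ else set0.
apply: (@negligibleS _ _ _ _ (\bigcup_k F k)).
  move=> t /= [At t01]; exists (dyadic_cell n t) => //.
  rewrite /F dyadic_cell_lt; last by move: t01; rewrite in_itv.
  by split => //; split => //; exact: hC.
apply: negligible_bigcup => k; rewrite /F; case: ifPn => [kn|_]; last first.
  exact: negligible_set0.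
by apply/negligibleP; [apply: mpre; exact: measurableI|exact: AC0].
Qed.

(** An atom [A] of the mixture is charged by some [nu n]. A subset that splits
    [A] properly for [nu n] also does so for the mixture, because the weight of
    [nu n] is positive; so [A] would be an atom of [nu n]. *)
Lemma non_atomic_mixture d (T : measurableType d) (R : realType)
    (nu : nat -> probability T R) :
  (forall n, non_atomic (nu n)) ->
  exists mu : probability T R, non_atomic mu /\
    forall n A, measurable A -> (0 < nu n A)%E -> (0 < mu A)%E.
Proof.
move=> nanu.
(* The total mass of these weights is 1. *)
have w_gt0 n : 0 < 1 / (2 ^ (n + 1))%:R :> R.
  by rewrite divr_gt0// ltr0n expn_gt0.
pose w n : {nonneg R} := NngNum (ltW (w_gt0 n)).
pose m := mseries (fun n => mscale (w n) (nu n)) 0.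
have mT : m setT = 1%E.
  rewrite /m /mseries.
  rewrite (_ : (fun _ => _) = eseries (fun n => (1 / (2 ^ (n + 1))%:R)%:E)).
    have := @cvg_geometric_eseries_half R 1 0; rewrite expr0 divr1.
    by move/cvg_lim; apply.
  apply/funext => n; apply: eq_bigr => i _.
  change (((w i)%:num)%:E * nu i [set: T] = (1 / (2 ^ (i + 1))%:R)%:E)%E.
  by rewrite probability_setT mule1.
pose mu : probability T R := HB.pack m (Measure_isProbability.Build _ _ _ m mT).
have wnu_ge0 n A : (0 <= (w n)%:num%:E * nu n A)%E by rewrite mule_ge0.
have pos n A : measurable A -> (0 < nu n A)%E -> (0 < mu A)%E.
  move=> mA nA; apply: (@lt_le_trans _ _ ((w n)%:num%:E * nu n A)%E).
    by rewrite mule_gt0 // lte_fin; exact: w_gt0.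
  have := @nneseries_lim_ge R (fun k => ((w k)%:num%:E * nu k A)%E)
    xpredT 0 n.+1.
  move=> /(_ (fun k _ _ => wnu_ge0 k A)); apply: le_trans.
  rewrite big_nat_recr//= leeDr// sume_ge0 // => i _; exact: wnu_ge0.
exists mu; split => // A [mA A0 atomA].
have [n nA] : exists n, (0 < nu n A)%E.
  apply: contrapT => /forallNP nA.
  suff m0 : m A = 0%E by have : (0 < m A)%E := A0; rewrite m0 ltxx.
  rewrite /m /mseries eseries0// => i _ _.
  change (((w i)%:num)%:E * nu i A = 0)%E.
  by have /negP := nA i; rewrite -leNgt measure_le0 => /eqP ->; rewrite mule0.
apply: (nanu n A); split => // B mB BA nBA.
apply/eqP; apply: contrapT => /negP nB.
have mAB : measurable (A `\` B) by exact: measurableD.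
have AIB : A `&` B = B by exact/setIidr.
have nAB : (0 < nu n (A `\` B))%E.
  rewrite lt0e measure_ge0 andbT; apply/negP => /eqP nAB0; move: nBA.
  by rewrite (measureDI (nu n) mA mB) AIB [X in (_ < X + _)%E]nAB0 add0e ltxx.
have muBA : (mu B < mu A)%E.
  rewrite (measureDI mu mA mB) AIB lteDr ?fin_num_measure//.
  exact: pos nAB.
have := atomA B mB BA muBA; apply/eqP; rewrite gt_eqF//.
by apply: (pos n) => //; rewrite lt0e nB measure_ge0.
Qed.

(** * The theorem *)

Theorem corollary2p12 (R : realType) (G : groupType) (S : set G)
    (finS : finite_set S) (genS : generates S)
    (X : metricType R) (compactX : compact [set: X])
    (no_isolated : isolated [set: X] = set0)
    (phi : G * X -> X) (phi_action : continuous_action phi) :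
  (forall (x0 : X) (mu : probability (borelType x0) R),
     non_atomic mu -> compatible S phi mu) ->
  persistent_shadowing S phi.
Proof.
move=> compat eps eps0; apply: contrapT => nodelta.
have /choice[bad badP] : forall n : nat, exists pf : (G * X -> X) * (G -> X),
    [/\ continuous_action pf.1, (action_dist S phi pf.1 < n.+1%:R^-1%:E)%E,
        pseudo_orbit S pf.1 n.+1%:R^-1 pf.2 &
        forall p, ~ shadowed pf.1 eps pf.2 p].
  move=> n; apply: contrapT => nobad; apply: nodelta.
  exists n.+1%:R^-1; first by rewrite invr_gt0.
  move=> psi apsi dpsi f pof; apply: contrapT => nsh; apply: nobad.
  by exists (psi, f); split => // p shp; apply: nsh; exists p.
have /choice[r rP] : forall n : nat, exists r : R, 0 < r /\
    ball ((bad n).2 1%g) r `&` Sh S (bad n).1 n.+1%:R^-1 (eps / 2) = set0.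
  move=> n; have [aP _ poP nshP] := badP n.
  have n0 : 0 < n.+1%:R^-1 :> R by rewrite invr_gt0.
  have [r r0 rP] := unshadowed_ball_disjoint_Sh finS aP n0 eps0 poP nshP.
  by exists r.
pose x0 := (bad 0%N).2 1%g.
have /choice[nu nuP] : forall n : nat, exists nu : probability (borelType x0) R,
    non_atomic nu /\ nu (ball ((bad n).2 1%g) (r n)) = 1%E.
  by move=> n; have [r0 _] := rP n; exact: exists_non_atomic.
have [mu [namu mupos]] := non_atomic_mixture (fun n => (nuP n).1).
have eps20 : 0 < eps / 2 by rewrite divr_gt0.
have [delta delta0 deltaP] := compat x0 mu namu _ eps20.
pose n := Num.truncn delta^-1.
have ndelta : n.+1%:R^-1 < delta.
  by rewrite invf_plt ?posrE// truncnS_gt.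
have [aP dP _ _] := badP n; have [_ disj] := rP n.
have mball : measurable (ball ((bad n).2 1%g) (r n) : set (borelType x0)).
  by apply: sub_sigma_algebra; exact: metric_ball_open.
have mupos_n : (0 < mu (ball ((bad n).2 1%g) (r n)))%E.
  by apply: (mupos n) => //; have [_ ->] := nuP n; exact: lte01.
have [|y [yb ySh]] := deltaP _ mball mupos_n _ aP.
  by apply: lt_trans dP _; rewrite lte_fin.
suff : (ball ((bad n).2 1%g) (r n) `&`
        Sh S (bad n).1 n.+1%:R^-1 (eps / 2)) y by rewrite disj.
split => // f pof f1; apply: ySh => // s g Ss.
exact: lt_trans (pof s g Ss) ndelta.
Qed.
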